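(* Let $\mathbf{s}=(s_1,s_2,\ldots)$ be a sequence of positive integers. The polynomial $Q_1^{(\mathbf{s})}(x)$ is palindromic for all $\mathbf{s}$. For $n\ge2$, write $\frac{s_n}{s_{n-1}}=\frac{p}{q}$, where $p,q$ are positive integers with $\gcd(p,q)=1$. Then $Q_n^{(\mathbf{s})}(x)$ is palindromic if and only if $Q_{n-1}^{(\mathbf{s})}(x)$ is palindromic and $p\,e^*_{n-1}\equiv-1\pmod q$.
   Context: For a sequence $\mathbf{s}$ of positive integers and $n\ge1$, let $\mathbf{v}_i=(0,\ldots,0,s_i,s_{i+1},\ldots,s_n)\in\mathbb{R}^n$ (first $i-1$ coordinates zero) for $1\le i\le n$, and let $\Pi_n^{(\mathbf{s})}=\left\{\sum_{i=1}^n\alpha_i\mathbf{v}_i \mid 0\le\alpha_i<1\right\}$. The $n$th inflated $\mathbf{s}$-Eulerian polynomial is $Q_n^{(\mathbf{s})}(x)=\sum_{\lambda\in\Pi_n^{(\mathbf{s})}\cap\mathbb{Z}^n}x^{\lambda_n}$. A polynomial $P(x)=\sum_{k=0}^d a_kx^k$ with $a_d>0$ and $a_0\ne0$ is palindromic if $a_k=a_{d-k}$ for $0\le k\le d$. The $\mathbf{s}$-inversion sequences are $I_n^{(\mathbf{s})}=\{\mathbf{e}=(e_1,\ldots,e_n)\in\mathbb{Z}^n\mid 0\le e_i<s_i \text{ for } 1\le i\le n\}$. For $\mathbf{e}\in I_n^{(\mathbf{s})}$, an index $1\le i<n$ is an ascent of $\mathbf{e}$ if $\frac{e_i}{s_i}<\frac{e_{i+1}}{s_{i+1}}$,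 and $0$ is an ascent if $e_1>0$; $\mathrm{asc}\,\mathbf{e}$ is the number of ascents of $\mathbf{e}$. $\mathbf{e}^*=(e_1^*,\ldots,e_n^* )\in I_n^{(\mathbf{s})}$ denotes the inversion sequence which achieves the largest possible value of $\mathrm{asc}\,\mathbf{e}$ over $\mathbf{e}\in I_n^{(\mathbf{s})}$ and such that $e_n^*\le e_n$ for all $\mathbf{e}\in I_n^{(\mathbf{s})}$ with $\mathrm{asc}\,\mathbf{e}=\mathrm{asc}\,\mathbf{e}^*$, and which has the same property on prefixes: for every $1\le j<n$, $(e_1^*,\ldots,e_j^* )$ maximizes $s_j\,\mathrm{asc}\,\mathbf{e}-e_j$ over $\mathbf{e}\in I_j^{(\mathbf{s})}$. In particular $e_{n-1}^*$ is the smallest last entry among those elements of $I_{n-1}^{(\mathbf{s})}$ with the largest number of ascents. *)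

(* Defs.v *)
From HB Require Import structures.
From mathcomp Require Import all_boot all_order all_algebra.
From mathcomp Require Import finmap.
From mathcomp Require Import all_classical all_reals.
From mathcomp Require Import zify lra.

Set Implicit Arguments.
Unset Strict Implicit.
Unset Printing Implicit Defensive.

Import Order.TTheory GRing.Theory Num.Theory.

Local Open Scope classical_set_scope.
Local Open Scope ring_scope.

(* A sequence [s_1, s_2, ...] is a function [s : nat -> nat] used only at
   indices [i >= 1]; [s 0] is irrelevant.  Matrix columns are numbered from 0,
   so the column [j : 'I_n] is the coordinate [j.+1] of the vector. *)

Definition vgen (R : realType) (s : nat -> nat) (n : nat) (i : 'I_n) :
    'rV[R]_n :=
  \row_(j < n) (if (i <= j)%N then (s j.+1)%:R else 0).

Definition parallelepiped (R : realType) (s : nat -> nat) (n : nat) :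
    set 'rV[R]_n :=
  [set \sum_(i < n) a i *: vgen R s i
     | a in [set a : 'I_n -> R | forall i, 0 <= a i < 1]].
Arguments parallelepiped : clear implicits.

Definition lattice_points (R : realType) (s : nat -> nat) (n : nat) :
    set 'rV[int]_n :=
  [set l | parallelepiped R s n (map_mx intr l)].
Arguments lattice_points : clear implicits.

Definition last_coord (n : nat) : 'rV[int]_n -> int :=
  match n with
  | 0 => fun=> 0
  | m.+1 => fun l => l 0 ord_max
  end.

(* The lattice points form a finite set and have nonnegative last coordinate
   ([lattice_points_finite], [last_coord_ge0]), so neither the finitely
   supported sum nor the absolute value alters the intended polynomial. *)
Definition inflated_eulerian (R : realType) (s : nat -> nat) (n : nat) :
    {poly int} :=
  \sum_(l \in lattice_points R s n) ('X^`|last_coord l|%N : {poly int}).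

Definition palindromic (P : {poly int}) : Prop :=
  let d := (size P).-1 in
  [/\ 0 < P`_d, P`_0 != 0 & forall k, (k <= d)%N -> P`_k = P`_(d - k)].

(* [entry e i] is [e_i] in the numbering [e = (e_1, ..., e_n)]. *)
Definition entry (e : seq nat) (i : nat) : nat := nth 0%N e i.-1.

Definition inversion_seq (s : nat -> nat) (n : nat) (e : seq nat) : Prop :=
  size e = n /\ forall i, (1 <= i <= n)%N -> (entry e i < s i)%N.

Definition asc (s : nat -> nat) (e : seq nat) : nat :=
  ((0 < entry e 1) +
   \sum_(1 <= i < size e)
     ((entry e i)%:Q / (s i)%:Q < (entry e i.+1)%:Q / (s i.+1)%:Q)%R)%N.

(* [is_estar s n e] says that [e] is the sequence e^* of length [n];
   it exists and is unique by [estar_exists] and [estar_unique]. *)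
Definition is_estar (s : nat -> nat) (n : nat) (e : seq nat) : Prop :=
  [/\ inversion_seq s n e,
      forall f, inversion_seq s n f -> (asc s f <= asc s e)%N,
      forall f, inversion_seq s n f -> asc s f = asc s e ->
        (entry e n <= entry f n)%N
    & forall j, (1 <= j < n)%N ->
        forall f, inversion_seq s j f ->
          (s j * asc s f)%:Z - (entry f j)%:Z <=
          (s j * asc s (take j e))%:Z - (entry (take j e) j)%:Z].

Lemma inversion_take s n e j :
  inversion_seq s n e -> (j <= n)%N -> inversion_seq s j (take j e).
Proof.
move=> [se he] jn; split; first by rewrite size_takel // se.
move=> i /andP[i1 ij]; rewrite /entry nth_take; last by lia.
by apply: he; lia.
Qed.

Lemma entry_rcons e x i :
  (0 < i)%N -> (i <= size e)%N -> entry (rcons e x) i = entry e i.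
Proof.
by case: i => // i _ ie; rewrite /entry /= nth_rcons ie.
Qed.

Lemma asc_rcons s m e x : size e = m.+1 ->
  asc s (rcons e x) =
  (asc s e + ((entry e m.+1)%:Q / (s m.+1)%:Q < x%:Q / (s m.+2)%:Q)%R)%N.
Proof.
move=> se; rewrite /asc size_rcons se big_nat_recr //= addnA.
rewrite entry_rcons ?se // entry_rcons ?se //.
congr (_ + _ + _)%N; last by rewrite /entry /= nth_rcons se ltnn eqxx.
by apply: eq_big_nat => i hi; rewrite !entry_rcons ?se //; lia.
Qed.

Definition lexopt (s : nat -> nat) (j : nat) (e : seq nat) : Prop :=
  inversion_seq s j e /\
  forall f, inversion_seq s j f ->
    (asc s f < asc s e)%N \/ (asc s f = asc s e /\ (entry e j <= entry f j)%N).

Lemma inversion_rcons s m e x : inversion_seq s m.+1 e -> (x < s m.+2)%N ->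
  inversion_seq s m.+2 (rcons e x).
Proof.
move=> [se he] hx; split; first by rewrite size_rcons se.
move=> i /andP[i1 im]; have [->|ne] := eqVneq i m.+2.
  by rewrite /entry /= nth_rcons se ltnn eqxx.
by rewrite entry_rcons ?se //; [apply: he; lia | lia].
Qed.

Lemma lexopt_exists s m : (forall i, (0 < i)%N -> (0 < s i)%N) ->
  exists e, size e = m.+1 /\
    forall j, (1 <= j <= m.+1)%N -> lexopt s j (take j e).
Proof.
move=> hs; elim: m => [|m [e [se he]]].
  have s1 := hs 1%N isT.
  exists [:: (1 < s 1)%N : nat]; split => // j hj.
  have -> : j = 1%N by lia.
  split.
    split => // i hi; have -> : i = 1%N by lia.
    by rewrite /entry /=; lia.
  case=> [|a [|b f]] [] // _ /(_ 1%N isT).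
  by rewrite /asc !big_geq // /entry /= !addn0; lia.
have hopt : lexopt s m.+1 e.
  by have := he m.+1; rewrite take_oversize ?se //; apply; lia.
pose P x := (x < s m.+2)%N &&
  ((entry e m.+1)%:Q / (s m.+1)%:Q < x%:Q / (s m.+2)%:Q)%R.
have split_last f : inversion_seq s m.+2 f ->
    exists g y, [/\ f = rcons g y, inversion_seq s m.+1 g & (y < s m.+2)%N].
  case/lastP: f => [|g y] If; first by case: If.
  have [sf hf] := If; move: sf; rewrite size_rcons => -[sg].
  exists g, y; split => //.
    have := inversion_take If (leqnSn m.+1).
    by rewrite -cats1 take_cat sg ltnn subnn cats0.
  have := hf m.+2; rewrite /entry /= nth_rcons sg ltnn eqxx.
  by apply; lia.
have lastE g y : size g = m.+1 -> entry (rcons g y) m.+2 = y.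
  by move=> sg; rewrite /entry /= nth_rcons sg ltnn eqxx.
suff [x hx] : exists x, lexopt s m.+2 (rcons e x).
  exists (rcons e x); rewrite size_rcons se; split => // j hj.
  have [->|ne] := eqVneq j m.+2.
    by rewrite take_oversize ?size_rcons ?se.
  rewrite -cats1 takel_cat ?se; last by lia.
  by apply: he; lia.
have [Ie oe] := hopt.
have sm1 : (0 : rat) < (s m.+1)%:Q by rewrite ltr0z ltz_nat hs.
have [[x0 Px0]|noP] := pselect (exists x, P x).
  have exP : exists x, P x by exists x0.
  case: (ex_minnP exP) => x /andP[xs xr] xmin; exists x.
  split; first exact: inversion_rcons.
  move=> _ /split_last[g [y [-> Ig ys]]]; have [sg _] := Ig.
  rewrite !(asc_rcons _ _ se) (asc_rcons _ _ sg) xr !lastE //.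
  have [h|[h1 h2]] := oe g Ig.
    left; case: (_ < _)%R => /=; rewrite ?addn1 ?addn0; lia.
  case: ltP => [ylt|_]; last by left; rewrite h1; lia.
  right; split; first by rewrite h1.
  apply: xmin; rewrite /P ys /=; apply: le_lt_trans ylt.
  by rewrite ler_pM2r ?invr_gt0 // ler_int lez_nat.
exists 0%N; split; first by apply: inversion_rcons => //; apply: hs.
move=> _ /split_last[g [y [-> Ig ys]]]; have [sg _] := Ig.
rewrite !(asc_rcons _ _ se) (asc_rcons _ _ sg) !lastE //.
have -> : ((entry e m.+1)%:Q / (s m.+1)%:Q < 0%N%:Q / (s m.+2)%:Q)%R = false.
  apply/negbTE/negP => h; apply: noP; exists 0%N.
  by rewrite /P h andbT hs.
have [h|[h1 h2]] := oe g Ig.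
  case: (_ < _)%R => /=; lia.
case: ltP => [ylt|_]; last by right; rewrite h1.
exfalso; apply: noP; exists y; rewrite /P ys /=; apply: le_lt_trans ylt.
by rewrite ler_pM2r ?invr_gt0 // ler_int lez_nat.
Qed.

Lemma estar_exists s n : (forall i, (0 < i)%N -> (0 < s i)%N) -> (0 < n)%N ->
  exists e, is_estar s n e.
Proof.
case: n => // m hs _; have [e [se he]] := lexopt_exists m hs.
exists e; have [Ie oe] : lexopt s m.+1 e.
  by have := he m.+1; rewrite take_oversize ?se //; apply; lia.
split => //.
- by move=> f /oe; lia.
- by move=> f /oe; lia.
move=> j /andP[j1 jm] f If.
have [|[_ hI] /(_ f If) o] := he j; first lia.
have := hI j; rewrite j1 leqnn => /(_ isT).
by move: o; move: (asc s f) (asc s _) (entry f j) (entry _ j) => a b c d; nia.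
Qed.

Lemma estar_unique s n e f :
  is_estar s n e -> is_estar s n f -> e = f.
Proof.
move=> [Ie e1 e2 e3] [If f1 f2 f3].
have [se he] := Ie; have [sf hf] := If.
apply: (@eq_from_nth _ 0%N); first by rewrite se sf.
move=> i; rewrite se => hi.
have [ni|ni] := eqVneq i.+1 n.
  have ea : asc s e = asc s f by apply/eqP; rewrite eqn_leq f1 ?e1.
  have := e2 f If (esym ea); have := f2 e Ie ea.
  by rewrite /entry -ni /=; lia.
have hj : (1 <= i.+1 < n)%N by lia.
have := e3 _ hj _ (inversion_take If (ltnW (proj2 (andP hj)))).
have := f3 _ hj _ (inversion_take Ie (ltnW (proj2 (andP hj)))).
have ei : (nth 0 e i < s i.+1)%N by apply: (he i.+1); lia.
have fi : (nth 0 f i < s i.+1)%N by apply: (hf i.+1); lia.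
rewrite /entry /= !nth_take //.
case: (ltngtP (asc s (take i.+1 e)) (asc s (take i.+1 f))) => [lt|lt|->].
- by have := leq_mul2l (s i.+1) (asc s (take i.+1 e)).+1 (asc s (take i.+1 f));
    rewrite lt orbT mulnS; lia.
- by have := leq_mul2l (s i.+1) (asc s (take i.+1 f)).+1 (asc s (take i.+1 e));
    rewrite lt orbT mulnS; lia.
by lia.
Qed.

Lemma parallelepiped_bounds (R : realType) s n (v : 'rV[R]_n) :
  parallelepiped R s n v ->
  forall j : 'I_n, 0 <= v 0 j <= (n * s j.+1)%:R.
Proof.
move=> [a ha <-] j; rewrite summxE; apply/andP; split.
  apply: sumr_ge0 => i _; rewrite !mxE; have /andP[ai0 _] := ha i.
  by case: ifP => _; rewrite ?mulr0 // mulr_ge0.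
rewrite natrM mulr_natl -[n in _ *+ n]card_ord -sumr_const.
apply: ler_sum => i _; rewrite !mxE; have /andP[ai0 /ltW ai1] := ha i.
case: ifP => _; last by rewrite mulr0.
by rewrite ler_piMl.
Qed.

Lemma lattice_points_bounds (R : realType) s n (l : 'rV[int]_n) :
  lattice_points R s n l ->
  forall j : 'I_n, 0 <= l 0 j <= (n * s j.+1)%:Z.
Proof.
move=> /parallelepiped_bounds h j; have := h j; rewrite mxE.
by rewrite ler0z -[(n * _)%:R]/((n * s j.+1)%:Z%:~R) ler_int.
Qed.

Lemma last_coord_ge0 (R : realType) s n (l : 'rV[int]_n) :
  lattice_points R s n l -> 0 <= last_coord l.
Proof.
by case: n l => // m l /lattice_points_bounds /(_ ord_max) /andP[].
Qed.

Lemma lattice_points_finite (R : realType) s n :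
  finite_set (lattice_points R s n).
Proof.
pose N := (\max_(j < n) (n * s j.+1)).+1%N.
pose g (f : {ffun 'I_n -> 'I_N}) : 'rV[int]_n := \row_j (f j : nat)%:Z.
have fg : finite_set (g @` setT) by apply: finite_image; apply: finite_finset.
apply: sub_finite_set fg.
move=> l /lattice_points_bounds h.
have hN (j : 'I_n) : (`|l 0%R j| < N)%N.
  have /andP[h0 h1] := h j; rewrite ltnS.
  apply: (leq_trans _ (leq_bigmax j)).
  by rewrite -lez_nat gez0_abs.
exists [ffun j => Ordinal (hN j)] => //.
apply/rowP => j; rewrite !mxE ffunE /=.
by have /andP[h0 _] := h j; rewrite gez0_abs.
Qed.

(* Main.v *)
(**
A lattice point lambda = sum_i alpha_i v_i of Pi_n is determined by the numbers
alpha_i in [0,1), where alpha_{i+1} = lambda_{i+1}/s_{i+1} - lambda_i/s_i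
(with s_0 = 1, lambda_0 = 0).  Fix a lattice point tau in Pi_n.  Reducing
tau - lambda modulo the lattice spanned by the v_i is an involution of the
lattice points; the image has last coordinate tau_n - lambda_n + s_n k, where k
counts the indices with alpha_i(tau) < alpha_i(lambda).  If Q_n is palindromic
and tau_n is its degree, the exponents sum to half of deg Q_n times their
number, which forces every k to vanish: tau maximises all the alpha_i at once.
Conversely such a tau makes Q_n palindromic.  Thus Q_n is palindromic if and
only if Pi_n has such a "top" lattice point.

A top point of Pi_n restricts to a top point t of Pi_{n-1}.  By Bezout, the
largest value of alpha_n is (pqg - 1)/(pqg) with g = gcd(s_{n-1}, s_n), and a
top point t of Pi_{n-1} extends to one of Pi_n exactly when
q z - p t_{n-1} = pqg - 1 has an integer solution z, that is
p t_{n-1} = 1 mod q.  Finally t_{n-1} = s_{n-1} asc(e) - e_{n-1} for the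
optimal inversion sequence e, and q divides s_{n-1}.
*)
Require Import Defs.
From mathcomp Require Import all_boot all_order all_algebra.
From mathcomp Require Import all_classical all_reals.
From mathcomp Require Import finmap zify ring lra.

Set Implicit Arguments.
Unset Strict Implicit.
Unset Printing Implicit Defensive.

Import Order.TTheory GRing.Theory Num.Theory.

Local Open Scope ring_scope.

(** * Boxes and reduction modulo the generators *)

(* This is s_i s_{i+1} alpha_{i+1}, so that the lattice points of the
   parallelepiped are the integer points of the box below. *)
Definition gap (s : nat -> nat) (x : nat -> int) (i : nat) : int :=
  (s i)%:Z * x i.+1 - (s i.+1)%:Z * x i.

Definition width (s : nat -> nat) (i : nat) : int := (s i)%:Z * (s i.+1)%:Z.

Definition box (s : nat -> nat) (n : nat) (x : nat -> int) : Prop :=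
  x 0%N = 0 /\ forall i, (i < n)%N -> 0 <= gap s x i < width s i.

(* Reduction modulo the lattice spanned by the generators v_i. *)
Definition reduce (s : nat -> nat) (x : nat -> int) (i : nat) : int :=
  x i - (s i)%:Z * \sum_(j < i) (gap s x j %/ width s j)%Z.

Definition top_point (s : nat -> nat) (n : nat) (t : nat -> int) : Prop :=
  box s n t /\
  forall x, box s n x -> forall i, (i < n)%N -> gap s x i <= gap s t i.

Lemma width_gt0 s i : (forall i, (0 < s i)%N) -> 0 < width s i.
Proof. by move=> hs; rewrite mulr_gt0 // ltz_nat hs. Qed.

Lemma box_ext s n (x y : nat -> int) :
  (forall i, (i <= n)%N -> x i = y i) -> box s n x -> box s n y.
Proof.
move=> xy [x0 hx]; split=> [|i hi]; first by rewrite -xy.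
by rewrite /gap -!xy ?(ltnW hi) //; exact: hx.
Qed.

Lemma boxW s m n x : (m <= n)%N -> box s n x -> box s m x.
Proof.
by move=> mn [x0 hx]; split=> // i hi; apply: hx; apply: leq_trans mn.
Qed.

(** Since s_i x_{i+1} = gap_i + s_{i+1} x_i with positive s, each coordinate is increasing in all
    earlier gaps. *)
Lemma gap_le s n (x y : nat -> int) :
  (forall i, (0 < s i)%N) -> x 0%N <= y 0%N ->
  (forall i, (i < n)%N -> gap s x i <= gap s y i) ->
  forall i, (i <= n)%N -> x i <= y i.
Proof.
move=> hs xy0 xy; elim=> // i IHi hi.
have := xy i hi; have := IHi (ltnW hi); rewrite /gap => le_i le_gap.
have s0 : 0 < (s i)%:Z by rewrite ltz_nat hs.
have s1 : 0 <= (s i.+1)%:Z by [].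
by rewrite -(ler_pM2l s0); have := ler_wpM2l s1 le_i; lra.
Qed.

Lemma gap_inj s n (x y : nat -> int) :
  (forall i, (0 < s i)%N) -> x 0%N = y 0%N ->
  (forall i, (i < n)%N -> gap s x i = gap s y i) ->
  forall i, (i <= n)%N -> x i = y i.
Proof.
move=> hs xy0 xy i hi; apply/eqP; rewrite eq_le; apply/andP; split.
  by apply: (gap_le (n := n) hs) => // [|j hj]; rewrite ?xy0 ?xy.
by apply: (gap_le (n := n) hs) => // [|j hj]; rewrite ?xy0 ?xy.
Qed.

Lemma gapB s x y i : gap s (fun j => x j - y j) i = gap s x i - gap s y i.
Proof. by rewrite /gap; ring. Qed.

(** The quotient sums at [i] and [i.+1] differ by one term, so exactly one multiple of the width is
    subtracted. *)
Lemma gap_reduce s x i : gap s (reduce s x) i = (gap s x i %% width s i)%Z.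
Proof.
rewrite /modz {1}/gap /reduce big_ord_recr /=.
by rewrite [X in _ = X - _]/gap /width; ring.
Qed.

Lemma reduce0 s x : x 0%N = 0 -> reduce s x 0 = 0.
Proof. by rewrite /reduce big_ord0 mulr0 subr0. Qed.

Lemma box_reduce s n x : (forall i, (0 < s i)%N) -> x 0%N = 0 ->
  box s n (reduce s x).
Proof.
move=> hs x0; split=> [|i _]; first exact: reduce0.
by have w0 := width_gt0 i hs; rewrite gap_reduce modz_ge0 ?gt_eqF // ltz_pmod.
Qed.

Lemma reduce_id s n x : (forall i, (0 < s i)%N) -> box s n x ->
  forall i, (i <= n)%N -> reduce s x i = x i.
Proof.
move=> hs [x0 hx]; apply: gap_inj => // [|i hi]; first by rewrite reduce0.
by rewrite gap_reduce modz_small //; exact: hx.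
Qed.

(** * Reflection of a box in one of its points *)

Definition reflect_box (s : nat -> nat) (t x : nat -> int) : nat -> int :=
  reduce s (fun i => t i - x i).

(** Two gaps in [0, width) differ by less than the width, so each quotient is 0 or -1, the latter
    exactly when the gap of [x] exceeds that of [t]. *)
Lemma reflect_boxE s n t x i : box s n t -> box s n x -> (i <= n)%N ->
  reflect_box s t x i =
  t i - x i + (s i)%:Z * \sum_(j < i) (gap s t j < gap s x j)%R%:Z.
Proof.
move=> [_ ht] [_ hx] hi; rewrite /reflect_box /reduce; congr (_ + _).
rewrite -mulrN -sumrN; congr (_ * _); apply: eq_bigr => j _.
have hj : (j < n)%N by apply: leq_trans hi.
have /andP[t0 tw] := ht j hj; have /andP[x0 xw] := hx j hj.
rewrite gapB; case: ltP => [lt_tx|le_xt].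
  have -> : gap s t j - gap s x j =
      -1 * width s j + (gap s t j - gap s x j + width s j) by ring.
  rewrite divzMDl ?divz_small ?gtz0_abs //; lia.
rewrite divz_small ?gtz0_abs //; lia.
Qed.

Lemma reflect_boxK s n t x : (forall i, (0 < s i)%N) ->
  box s n t -> box s n x ->
  forall i, (i <= n)%N -> reflect_box s t (reflect_box s t x) i = x i.
Proof.
move=> hs [t0 ht] [x0 hx]; apply: gap_inj => //.
  by rewrite x0 /reflect_box !reduce0 ?t0 ?x0 ?subr0.
move=> i hi; rewrite gap_reduce gapB gap_reduce gapB.
by rewrite -modzDmr modzNm modzDmr opprB addrCA subrr addr0 modz_small ?hx.
Qed.

Lemma box_reflect s n t x : (forall i, (0 < s i)%N) ->
  box s n t -> box s n x -> box s n (reflect_box s t x).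
Proof. by move=> hs [t0 _] [x0 _]; apply: box_reduce; rewrite // t0 x0. Qed.

Lemma reflect_box_ge s n t x : (forall i, (0 < s i)%N) ->
  box s n t -> box s n x -> t n - x n <= reflect_box s t x n.
Proof.
move=> hs bt bx; rewrite (reflect_boxE bt bx) // lerDl mulr_ge0 //.
by apply: sumr_ge0.
Qed.

(** The excess over [t n - x n] is s_n times a sum of nonnegative indicators, which vanishes only if
    each of them does. *)
Lemma reflect_box_eq s n t x : (forall i, (0 < s i)%N) ->
  box s n t -> box s n x ->
  reflect_box s t x n = t n - x n <->
  forall i, (i < n)%N -> gap s x i <= gap s t i.
Proof.
move=> hs bt bx; rewrite (reflect_boxE bt bx) //.
have s0 : (s n)%:Z != 0 by rewrite gt_eqF // ltz_nat hs.
split=> [/eqP|le_xt].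
  rewrite -subr_eq0 addrAC subrr add0r mulf_eq0 (negbTE s0) /=.
  rewrite psumr_eq0 // => /allP all0 i hi.
  have := all0 (Ordinal hi) (mem_index_enum _) => /=.
  by case: ltP.
rewrite big1 ?mulr0 ?addr0 // => j _.
by rewrite ltNge le_xt.
Qed.

(** * Restricting and extending top points *)

Lemma top_pointW s n t : (forall i, (0 < s i)%N) ->
  top_point s n.+1 t -> top_point s n t.
Proof.
move=> hs [bt ht]; split; first exact: boxW bt.
(* [reduce s x] extends the shorter box point: it keeps the coordinates up to [n] and brings the
   next gap into range. *)
move=> x bx i hi; have red_x := reduce_id hs bx.
have := ht _ (box_reduce n.+1 hs bx.1) i (ltnW hi).
by rewrite {1}/gap !red_x // ltnW.
Qed.

(** All gaps at [n] are multiples of [g]. The Bezout coefficients give a vector with gap exactly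
    [-g] there, which reduces to width minus [g]. *)
Lemma box_gap_max s n p q g : (forall i, (0 < s i)%N) -> (0 < n)%N ->
  coprime p q -> s n = (q * g)%N -> s n.+1 = (p * g)%N ->
  exists x, box s n.+1 x /\ gap s x n = width s n - g%:Z.
Proof.
move=> hs n0 cpq sq sp.
have [u [v uv]] := Bezoutz p%:Z q%:Z.
have {}uv : u * p%:Z + v * q%:Z = 1 by rewrite uv /gcdz /= (eqP cpq).
have g0 : 0 < g%:Z by have := hs n; rewrite sq ltz_nat muln_gt0 => /andP[].
have pq0 : (0 < p * q)%N.
  have := hs n; have := hs n.+1.
  by rewrite sq sp !muln_gt0 => /andP[-> _] /andP[].
pose x i : int := if i == n then u else if i == n.+1 then - v else 0.
have x0 : x 0%N = 0 by rewrite /x; case: eqVneq => // e0; rewrite -e0 in n0.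
exists (reduce s x); split; first exact: box_reduce.
have -> : gap s (reduce s x) n =
    ((-1 * width s n + (width s n - g%:Z)) %% width s n)%Z.
  rewrite gap_reduce; congr (_ %% _)%Z.
  rewrite /gap /x eqxx (gtn_eqF (ltnSn n)) eqxx sq sp !PoszM.
  transitivity (- (g%:Z * (u * p%:Z + v * q%:Z))); first by ring.
  by rewrite uv; ring.
rewrite modzMDl modz_small //.
have : g%:Z <= width s n.
  rewrite /width sq sp -PoszM lez_nat.
  have -> : (q * g * (p * g) = g * (p * q * g))%N by lia.
  by rewrite leq_pmulr // muln_gt0 pq0.
by lia.
Qed.

(** The last gap is [g] times an integer, lies below the width g(pqg), and is at least width minus
    [g] by [box_gap_max]. *)
Lemma top_point_last_gap s n p q g t : (forall i, (0 < s i)%N) -> (0 < n)%N ->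
  coprime p q -> s n = (q * g)%N -> s n.+1 = (p * g)%N ->
  top_point s n.+1 t ->
  q%:Z * t n.+1 - p%:Z * t n = p%:Z * q%:Z * g%:Z - 1.
Proof.
move=> hs n0 cpq sq sp [[t0 ht] maxt].
have [x [bx gapx]] := box_gap_max hs n0 cpq sq sp.
have g0 : 0 < g%:Z by have := hs n; rewrite sq ltz_nat muln_gt0 => /andP[].
have /andP[_] := ht n (ltnSn n); have := maxt x bx n (ltnSn n).
rewrite gapx /gap /width sq sp !PoszM.
have -> : q%:Z * g%:Z * (p%:Z * g%:Z) - g%:Z = g%:Z * (p%:Z * q%:Z * g%:Z - 1).
  by ring.
have -> : q%:Z * g%:Z * t n.+1 - p%:Z * g%:Z * t n =
  g%:Z * (q%:Z * t n.+1 - p%:Z * t n) by ring.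
have -> : q%:Z * g%:Z * (p%:Z * g%:Z) = g%:Z * (p%:Z * q%:Z * g%:Z) by ring.
rewrite ler_pM2l // ltr_pM2l //; lia.
Qed.

(** The equation for [z] makes the new gap the largest multiple of [g] below the width; the earlier
    gaps are unchanged. *)
Lemma top_point_extend s n p q g t z : (forall i, (0 < s i)%N) ->
  s n = (q * g)%N -> s n.+1 = (p * g)%N -> top_point s n t ->
  q%:Z * z - p%:Z * t n = p%:Z * q%:Z * g%:Z - 1 ->
  top_point s n.+1 (fun i => if (i <= n)%N then t i else z).
Proof.
move=> hs sq sp [[t0 ht] maxt] tz.
set t' := (X in top_point _ _ X).
have g0 : 0 < g%:Z by have := hs n; rewrite sq ltz_nat muln_gt0 => /andP[].
have pq0 : (0 < p * q)%N.
  have := hs n; have := hs n.+1.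
  by rewrite sq sp !muln_gt0 => /andP[-> _] /andP[].
have gapt' i : (i < n)%N -> gap s t' i = gap s t i.
  by move=> hi; rewrite /gap /t' hi ltnW.
have gapn x : gap s x n = g%:Z * (q%:Z * x n.+1 - p%:Z * x n).
  by rewrite /gap sq sp !PoszM; ring.
have widthn : width s n = g%:Z * (p%:Z * q%:Z * g%:Z).
  by rewrite /width sq sp !PoszM; ring.
have gapt'n : gap s t' n = g%:Z * (p%:Z * q%:Z * g%:Z - 1).
  by rewrite gapn -tz /t' leqnn ltnn.
split=> [|x bx i].
  split=> [//|i]; rewrite ltnS leq_eqVlt => /predU1P[->|hi]; last first.
    by rewrite gapt' //; exact: ht.
  have pqg0 : 0 < p%:Z * q%:Z * g%:Z by rewrite mulr_gt0 // -PoszM ltz_nat.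
  by rewrite gapt'n widthn ltr_pM2l // pmulr_rge0 //; lia.
rewrite ltnS leq_eqVlt => /predU1P[->|hi]; last first.
  by rewrite gapt' //; apply: maxt => //; exact: boxW bx.
rewrite gapt'n gapn ler_pM2l //.
have /andP[_] := bx.2 n (ltnSn n).
by rewrite gapn widthn ltr_pM2l //; lia.
Qed.

(** * Inversion sequences and box points *)

(** With value 1 at index 0 and x_0 = 0, the gap at 0 is x_1 and the width is s_1, so the first
    coordinate obeys the same rule as the others. *)
Definition unit_at0 (s : nat -> nat) (i : nat) : nat :=
  if i is 0 then 1%N else s i.

Lemma ltr_nat_frac (a b c d : nat) : (0 < b)%N -> (0 < d)%N ->
  (a%:Q / b%:Q < c%:Q / d%:Q) = (a * d < c * b)%N.
Proof.
move=> b0 d0; rewrite ltr_pdivrMr ?ltr0z ?ltz_nat // mulrAC.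
by rewrite ltr_pdivlMr ?ltr0z ?ltz_nat // -!intrM ltr_int -!PoszM ltz_nat.
Qed.

Lemma inversion_seq_rconsP s m e : inversion_seq s m.+2 e ->
  exists g y, [/\ e = rcons g y, inversion_seq s m.+1 g & (y < s m.+2)%N].
Proof.
case/lastP: e => [|g y] Ie; first by case: Ie.
have [se he] := Ie; move: se; rewrite size_rcons => -[sg].
exists g, y; split=> //.
  have := inversion_take Ie (leqnSn m.+1).
  by rewrite -cats1 take_cat sg ltnn subnn cats0.
have := he m.+2; rewrite /entry /= nth_rcons sg ltnn eqxx.
by apply; lia.
Qed.

Lemma entry_rcons_last e y n : size e = n -> entry (rcons e y) n.+1 = y.
Proof. by move=> se; rewrite /entry /= nth_rcons se ltnn eqxx. Qed.

(** The point is x_j = s_j asc(e_1..e_j) - e_j. Its gap at j is s_j s_{j+1} [j is an ascent] + e_j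
    s_{j+1} - e_{j+1} s_j; the ascent term appears exactly when the rest is negative. *)
Lemma inversion_seq_box s n e : (forall i, (0 < i)%N -> (0 < s i)%N) ->
  inversion_seq s n.+1 e ->
  exists x, box (unit_at0 s) n.+1 x /\
    x n.+1 = (s n.+1)%:Z * (asc s e)%:Z - (entry e n.+1)%:Z.
Proof.
move=> hs; elim: n e => [|n IHn] e.
  case: e => [|a [|b e]] [] // _ /(_ 1%N isT); rewrite /entry /= => a_lt.
  exists (fun i => if i is 0 then 0 else (s 1%N)%:Z * (0 < a)%N%:Z - a%:Z).
  split; last by rewrite /asc /= big_geq //= addn0.
  split=> // -[|//] _; rewrite /gap /width /= mulr0 subr0 !mul1r.
  by case: a a_lt => [|a] /=; lia.
move=> /inversion_seq_rconsP[g [y [-> Ig y_lt]]].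
have [x [bx xn]] := IHn g Ig; have [sg hg] := Ig.
rewrite (asc_rcons _ _ sg) entry_rcons_last // ltr_nat_frac ?hs //.
pose z := (s n.+2)%:Z *
  (asc s g + (entry g n.+1 * s n.+2 < y * s n.+1))%N%:Z - y%:Z.
exists (fun i => if (i <= n.+1)%N then x i else z).
split; last by rewrite ltnn.
split=> [|i]; first exact: bx.1.
rewrite ltnS leq_eqVlt => /predU1P[->|hi]; last first.
  by rewrite /gap hi ltnW //; exact: bx.2.
rewrite /gap /width leqnn ltnn xn /z.
have := hg n.+1; rewrite leqnn => /(_ isT) a_lt.
move: (entry g n.+1) (asc s g) a_lt => a A a_lt.
rewrite /unit_at0; move: (s n.+1) (s n.+2) a_lt y_lt => S T a_lt y_lt.
have -> b : S%:Z * (T%:Z * (A + nat_of_bool b)%N%:Z - y%:Z) -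
    T%:Z * (S%:Z * A%:Z - a%:Z) = (S * T)%:Z * b%:Z + (a * T)%:Z - (y * S)%:Z.
  by rewrite !PoszM PoszD; ring.
have := leq_mul (leqnn T) a_lt; have := leq_mul (leqnn S) y_lt.
rewrite -PoszM !mulnS; case: ltnP => ? ? ?; lia.
Qed.

Lemma box_inversion_seq s n x : (forall i, (0 < i)%N -> (0 < s i)%N) ->
  box (unit_at0 s) n.+1 x ->
  exists e, inversion_seq s n.+1 e /\
    x n.+1 = (s n.+1)%:Z * (asc s e)%:Z - (entry e n.+1)%:Z.
Proof.
move=> hs; elim: n => [|n IHn] bx.
  have := bx.2 0%N isT; rewrite /gap /width bx.1 /= mulr0 subr0 !mul1r => x1.
  have s1 := hs 1%N isT.
  case: (x 1%N) x1 => // a /andP[_ a_lt].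
  (* A positive x_1 = a comes from the ascent at 0: s_1 - (s_1 - a) = a. *)
  exists [:: if a == 0%N then 0%N else (s 1%N - a)%N].
  rewrite /asc big_geq // /entry !nth0 /= addn0; split.
    split=> // i hi; have -> : i = 1%N by lia.
    by rewrite /entry nth0 /=; case: eqVneq; lia.
  by case: eqVneq => [->|a_neq0] /=; lia.
have [e [Ie xn]] := IHn (boxW (leqnSn _) bx); have [se he] := Ie.
have := bx.2 n.+1 (ltnSn _); rewrite /gap /width xn /=.
have := he n.+1; rewrite leqnn => /(_ isT) a_lt gap_x.
have s1 := hs n.+1 isT; have s2 := hs n.+2 isT.
have [y [y_lt xE]] : exists y : nat, (y < s n.+2)%N /\
    x n.+2 = (s n.+2)%:Z * (asc s e + (entry e n.+1 * s n.+2 < y * s n.+1))%N%:Z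
      - y%:Z.
  move: (entry e n.+1) (asc s e) (x n.+2) a_lt gap_x => a A z.
  move: (s n.+1) (s n.+2) s1 s2 => S T S0 T0 a_lt gap_x.
  (* The new entry is the residue of [w] modulo [T]. The gap bounds give -T < w < T; the entry is
     [w] without an ascent if w >= 0, and w + T with an ascent otherwise. *)
  pose w := T%:Z * A%:Z - z.
  have {gap_x} : 0 <= (a * T)%:Z - S%:Z * w < (S * T)%:Z.
    by move: gap_x; rewrite /w !PoszM; lra.
  have -> : z = T%:Z * A%:Z - w by rewrite /w; ring.
  move: w => w {z} /andP[w_ge w_lt].
  have aT : (a * T < S * T)%N by rewrite ltn_pmul2r.
  case: (lerP 0 w) => [w0|w0].
    case: w w0 w_ge w_lt => // w _ w_ge w_lt; exists w; split.
      by rewrite -(ltn_pmul2l S0); lia.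
    have -> : (a * T < w * S)%N = false by lia.
    by rewrite addn0.
  have wT : - T%:Z < w.
    by rewrite -(ltr_pM2l (_ : 0 < S%:Z)) ?ltz_nat //; lia.
  have [y wE] : exists y : nat, w = y%:Z - T%:Z.
    by exists `|(w + T%:Z)%R|%N; lia.
  exists y; split; first lia.
  have -> : (a * T < y * S)%N.
    by rewrite -ltz_nat !PoszM; move: w_lt; rewrite wE !PoszM; lra.
  by rewrite wE PoszD /=; ring.
exists (rcons e y); split; first exact: inversion_rcons.
by rewrite (asc_rcons _ _ se) entry_rcons_last // ltr_nat_frac.
Qed.

(** The values s_j asc(e) - e_j are exactly the last coordinates of box points. The prefix of e^*
    maximises the former and, by [gap_le], a top point the latter. *)
Lemma top_point_estar s n t e : (forall i, (0 < i)%N -> (0 < s i)%N) ->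
  top_point (unit_at0 s) n.+1 t -> is_estar s n.+2 e ->
  exists a : nat, t n.+1 = (s n.+1)%:Z * a%:Z - (entry e n.+1)%:Z.
Proof.
move=> hs [bt maxt] [Ie _ _ max_e]; exists (asc s (take n.+1 e)).
have Ij := inversion_take Ie (leqnSn n.+1).
have hj : (1 <= n.+1 < n.+2)%N by lia.
have entryE : entry (take n.+1 e) n.+1 = entry e n.+1.
  by rewrite /entry nth_take.
have [f [If tE]] := box_inversion_seq hs bt.
have [x [bx xE]] := inversion_seq_box hs Ij.
have := max_e _ hj _ If; rewrite !PoszM -tE -xE -entryE -xE => le_tx.
apply/eqP; rewrite eq_le le_tx.
apply: (gap_le (s := unit_at0 s) (n := n.+1)) => //.
- by case=> // i; exact: hs.
- by rewrite bx.1 bt.1.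
- exact: maxt.
Qed.

(** * Palindromic generating polynomials of finite lists *)

Lemma coef_sum_Xn (T : Type) (r : seq T) (w : T -> nat) k :
  (\sum_(l <- r) ('X^(w l) : {poly int}))`_k
  = (count (fun l => w l == k) r)%:Z.
Proof.
elim: r => [|l r IHr]; first by rewrite big_nil coef0.
by rewrite big_cons coefD IHr coefXn /= PoszD eq_sym natz.
Qed.

(* The derivative at 1 is the sum of the exponents, which a reflection
   k |-> d - k of the exponents determines. *)
Lemma palindromic_deriv (P : {poly int}) :
  palindromic P -> 2 * P^`().[1] = (size P).-1%:Z * P.[1].
Proof.
move=> [Pd _ Psym]; move: Pd Psym; set d := (size P).-1 => Pd Psym.
have szP : (size P <= d.+1)%N by rewrite /d; case: (size P).
have P1 : P.[1] = \sum_(k < d.+1) P`_k.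
  rewrite (horner_coef_wide _ szP).
  by apply: eq_bigr => k _; rewrite expr1n mulr1.
have dP1 : P^`().[1] = \sum_(k < d.+1) k%:Z * P`_k.
  have szdP : (size P^`() <= d)%N.
    apply/leq_sizeP => j dj.
    by rewrite coef_deriv nth_default ?mul0rn // (leq_trans szP).
  rewrite (horner_coef_wide _ szdP) big_ord_recl mul0r add0r.
  apply: eq_bigr => k _.
  by rewrite expr1n mulr1 coef_deriv /= -mulr_natl natz.
have dP1' : P^`().[1] = \sum_(k < d.+1) (d%:Z - k%:Z) * P`_k.
  rewrite dP1 (reindex_inj rev_ord_inj) /=; apply: eq_bigr => k _.
  have kd : (k <= d)%N by rewrite -ltnS.
  by rewrite subSS -(Psym k kd) -subzn.
rewrite mulr2n mulrDl mul1r {1}dP1 dP1' -big_split P1 mulr_sumr /=.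
by apply: eq_bigr => k _; ring.
Qed.

(** [t] is a term realising the degree; the value at 1 counts the terms, and the derivative at 1
    adds the exponents. *)
Lemma palindromic_sum_Xn (T : eqType) (r : seq T) (w : T -> nat) :
  palindromic (\sum_(l <- r) ('X^(w l) : {poly int})) ->
  exists2 t, t \in r &
    2 * \sum_(l <- r) (w l)%:Z = (w t)%:Z * (size r)%:Z.
Proof.
set P := (X in palindromic X) => palP; have [Pd _ _] := palP.
have [t tr /eqP wt] : exists2 t, t \in r & w t == (size P).-1.
  by apply/hasP; rewrite has_count -ltz_nat -coef_sum_Xn.
exists t => //; have := palindromic_deriv palP; rewrite -wt.
have -> : P.[1] = (size r)%:Z.
  rewrite horner_sum -sum1_size -natz natr_sum.
  by apply: eq_bigr => l _; rewrite hornerXn expr1n.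
have -> // : P^`().[1] = \sum_(l <- r) (w l)%:Z.
rewrite /P linear_sum horner_sum; apply: eq_bigr => l _ /=.
by rewrite derivXn hornerMn hornerXn expr1n natz.
Qed.

(** As [f] permutes [r], the excesses w(l) + w(f l) - d sum to zero; being nonnegative, they all
    vanish. *)
Lemma sum_reflect_eq (T : eqType) (r : seq T) (w : T -> nat) (f : T -> T) d :
  perm_eq (map f r) r ->
  2 * \sum_(l <- r) (w l)%:Z = d%:Z * (size r)%:Z ->
  (forall l, l \in r -> (d <= w l + w (f l))%N) ->
  forall l, l \in r -> (w l + w (f l) = d)%N.
Proof.
move=> perm_f sum_w le_d.
have sum0 : \sum_(l <- r | l \in r) ((w l)%:Z + (w (f l))%:Z - d%:Z) = 0.
  rewrite -big_seq sumrB big_split /=.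
  rewrite -(big_map f xpredT (fun l => (w l)%:Z)) (perm_big _ perm_f) /=.
  rewrite big_const_seq count_predT iter_addr_0 -mulr_natr natz -sum_w.
  by ring.
move=> l lr; have /eqP := sum0; rewrite psumr_eq0; last first.
  by move=> i /le_d; lia.
by move=> /allP/(_ l lr); rewrite lr /=; lia.
Qed.

(** [f] exchanges the weights k and d - k. The element [z] makes the constant coefficient nonzero,
    hence also that of degree [d], which no weight exceeds. *)
Lemma palindromic_reflect (T : eqType) (r : seq T) (w : T -> nat) (f : T -> T)
    d z :
  perm_eq (map f r) r -> (forall l, l \in r -> (w l + w (f l) = d)%N) ->
  z \in r -> w z = 0%N ->
  palindromic (\sum_(l <- r) ('X^(w l) : {poly int})).
Proof.
move=> perm_f wf zr wz; set P := (X in palindromic X).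
have P0 : P`_0 != 0.
  rewrite coef_sum_Xn eqz_nat -lt0n -has_count.
  by apply/hasP; exists z; rewrite ?wz.
have Psym k : (k <= d)%N -> P`_k = P`_(d - k).
  move=> kd; rewrite !coef_sum_Xn; congr Posz.
  have /permP/(_ (fun l => w l == k)) <- := perm_f.
  rewrite count_map; apply: eq_in_count => l lr /=.
  by have := wf l lr; move: (w l) (w (f l)) => a b; lia.
have Pd : P`_d != 0 by have := Psym 0%N isT; rewrite subn0 => <-.
have szP : size P = d.+1.
  apply/eqP; rewrite eqn_leq; apply/andP; split; last first.
    by rewrite ltnNge; apply: contra Pd => /leq_sizeP ->.
  apply/leq_sizeP => j dj; rewrite coef_sum_Xn.
  apply/eqP; rewrite eqz_nat -leqn0 leqNgt -has_count.
  by apply/hasP => -[l /wf]; move: (w l) (w (f l)) => a b; lia.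
by rewrite /palindromic szP /=; split=> //; rewrite lt0r Pd coef_sum_Xn.
Qed.

Lemma perm_map_involution (T : eqType) (r : seq T) (f : T -> T) :
  uniq r -> {in r, forall l, f l \in r} -> {in r, cancel f f} ->
  perm_eq (map f r) r.
Proof.
move=> ur fr fK; apply: uniq_perm => // [|l].
  by rewrite map_inj_in_uniq //; exact: can_in_inj fK.
apply/mapP/idP => [[k kr ->]|lr]; first exact: fr.
by exists (f l); rewrite ?fr ?fK.
Qed.

(** * Lattice points as box points, and the criterion for palindromicity *)

(** Index 0 holds the value 0 that [box] demands. Past [m.+1] the values are defaults of [inord], so
    equalities are only stated up to [m.+1]. *)
Definition coords (m : nat) (l : 'rV[int]_m.+1) (i : nat) : int :=
  if i is j.+1 then l 0 (inord j) else 0.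

Definition row_of (m : nat) (x : nat -> int) : 'rV[int]_m.+1 :=
  \row_j x j.+1.

Lemma coords_row_of m x i : x 0%N = 0 -> (i <= m.+1)%N ->
  coords (row_of m x) i = x i.
Proof. by case: i => // i _ im; rewrite /= mxE inordK. Qed.

Lemma row_of_coords m (l : 'rV[int]_m.+1) : row_of m (coords l) = l.
Proof. by apply/rowP => j; rewrite mxE /= inord_val. Qed.

Lemma unit_at0_gt0 s : (forall i, (0 < i)%N -> (0 < s i)%N) ->
  forall i, (0 < unit_at0 s i)%N.
Proof. by move=> hs [|i] //; exact: hs. Qed.

Lemma sum_vgenE (R : realType) s m (a : 'I_m.+1 -> R) (j : 'I_m.+1) :
  (\sum_(i < m.+1) a i *: vgen R s i) 0 j =
  (s j.+1)%:R * \sum_(i < j.+1) a (inord i).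
Proof.
rewrite summxE (big_ord_widen m.+1 (fun i => a (inord i))) // mulr_sumr.
rewrite [RHS]big_mkcond /=; apply: eq_bigr => i _.
by rewrite !mxE ltnS /= inord_val; case: ifP => _; rewrite ?mulr0 // mulrC.
Qed.

(** The coefficient of the generator with index [i] is gap_i / width_i; partial sums of these
    telescope to x_i / s_i. *)
Lemma lattice_points_box (R : realType) s m (l : 'rV[int]_m.+1) :
  (forall i, (0 < i)%N -> (0 < s i)%N) ->
  lattice_points R s m.+1 l <-> box (unit_at0 s) m.+1 (coords l).
Proof.
move=> hs; set S := unit_at0 s; have S_gt0 := unit_at0_gt0 hs.
have SR i : 0 < (S i)%:R :> R by rewrite ltr0n S_gt0.
split=> [[a a01 la]|[_ bl]].
  pose B i := \sum_(k < i) a (inord k).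
  have coordsE i : (i <= m.+1)%N -> (coords l i)%:~R = (S i)%:R * B i :> R.
    case: i => [|i] im; first by rewrite /B big_ord0 mulr0.
    have := congr1 (fun v : 'rV[R]_m.+1 => v 0 (inord i)) la.
    by rewrite sum_vgenE mxE inordK // => <-.
  split=> // i hi; have /andP[a0 a1] := a01 (inord i).
  have gapE : (gap S (coords l) i)%:~R = (width S i)%:~R * a (inord i) :> R.
    rewrite /gap /width !(intrB, intrM) !coordsE ?(ltnW hi) //.
    by rewrite /B big_ord_recr /= -!pmulrn; ring.
  have wR : 0 < (width S i)%:~R :> R by rewrite ltr0z width_gt0.
  by rewrite -(ler0z R) -(ltr_int R) gapE pmulr_rge0 // gtr_pMr // a0.
pose a i : R := (gap S (coords l) i)%:~R / (width S i)%:~R.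
have aE i : \sum_(k < i) a k = (coords l i)%:~R / (S i)%:R.
  elim: i => [|i IHi]; first by rewrite big_ord0 mul0r.
  rewrite big_ord_recr /= IHi /a /gap /width !(intrB, intrM) -!pmulrn.
  by field; rewrite !gt_eqF.
exists (fun i : 'I_m.+1 => a i).
  move=> i; have /andP[g0 gw] := bl i (ltn_ord i).
  have wR : 0 < (width S i)%:~R :> R by rewrite ltr0z width_gt0.
  by rewrite divr_ge0 ?ler0z ?(ltW wR) //= ltr_pdivrMr // mul1r ltr_int.
apply/rowP => j; rewrite sum_vgenE mxE.
under eq_bigr => i _ do rewrite inordK ?(leq_trans (ltn_ord i) (ltn_ord j)) //.
by rewrite aE -[s j.+1]/(S j.+1) mulrC mulfVK ?(gt_eqF (SR _)) //= inord_val.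
Qed.

Lemma reduce_ext s n x y : (forall i, (i <= n)%N -> x i = y i) ->
  forall i, (i <= n)%N -> reduce s x i = reduce s y i.
Proof.
move=> xy i hi; rewrite /reduce xy //; congr (_ - _ * _).
apply: eq_bigr => j _; have hj : (j < n)%N by apply: leq_trans hi.
by rewrite /gap !xy // ltnW.
Qed.

Lemma palindromic_top_point (R : realType) s m :
  (forall i, (0 < i)%N -> (0 < s i)%N) ->
  palindromic (inflated_eulerian R s m.+1) <->
  exists t, top_point (unit_at0 s) m.+1 t.
Proof.
move=> hs; have S_gt0 := unit_at0_gt0 hs; set S := unit_at0 s.
have finL := lattice_points_finite R s m.+1.
rewrite /inflated_eulerian fsbig_finite //=.
set r := enum_fset _; pose w (l : 'rV[int]_m.+1) := `|last_coord l|%N.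
have rP l : l \in r <-> box S m.+1 (coords l).
  rewrite -(lattice_points_box R _ hs) [l \in r](in_fset_set finL l).
  by split=> [/set_mem|/mem_set].
have wE l : l \in r -> (w l)%:Z = coords l m.+1.
  move=> /rP/(lattice_points_box R _ hs) ll.
  rewrite /w gez0_abs; last exact: last_coord_ge0 ll.
  by congr (l 0 _); apply/val_inj; rewrite /= inordK.
pose f t (l : 'rV[int]_m.+1) := row_of m (reflect_box S t (coords l)).
have fE t l i : box S m.+1 t -> l \in r -> (i <= m.+1)%N ->
    coords (f t l) i = reflect_box S t (coords l) i.
  move=> bt /rP bl im; apply: coords_row_of => //.
  by have [] := box_reflect S_gt0 bt bl.
have fr t l : box S m.+1 t -> l \in r -> f t l \in r.
  move=> bt lr; apply/rP; apply: box_ext (box_reflect S_gt0 bt ((rP l).1 lr)).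
  by move=> i im; rewrite fE.
have perm_f t : box S m.+1 t -> perm_eq (map (f t) r) r.
  move=> bt; apply: perm_map_involution => [|l lr|l lr].
  - exact: fset_uniq.
  - exact: fr.
  rewrite -[RHS]row_of_coords; apply/rowP => j; rewrite !mxE.
  rewrite -(reflect_boxK S_gt0 bt ((rP l).1 lr)) //.
  by apply: (@reduce_ext _ m.+1) => // i im; rewrite fE.
split=> [/palindromic_sum_Xn[t tr sum_w]|[t [bt maxt]]].
  have bt := (rP t).1 tr; exists (coords t); split=> // x bx.
  have xE i : (i <= m.+1)%N -> coords (row_of m x) i = x i.
    by apply: coords_row_of; exact: bx.1.
  have xr : row_of m x \in r.
    by apply/rP; apply: box_ext bx => i /xE.
  (* With [t] of maximal weight, this bound and the average of the weights force equality for every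
     [l], so [t] dominates all gaps. *)
  have w_f l : l \in r -> (w t <= w l + w (f (coords t) l))%N.
    move=> lr; rewrite -lez_nat PoszD !wE ?fr // fE // -lerBlDl.
    by apply: reflect_box_ge => //; apply/rP.
  have := sum_reflect_eq (perm_f _ bt) sum_w w_f xr.
  move=> /(congr1 Posz); rewrite PoszD !wE ?fr // fE // => w_eq.
  have /reflect_box_eq-/(_ S_gt0 bt ((rP _).1 xr)) gap_x :
    reflect_box S (coords t) (coords (row_of m x)) m.+1 =
    coords t m.+1 - coords (row_of m x) m.+1 by rewrite -w_eq; ring.
  move=> i im; have := gap_x i im.
  by rewrite [X in X <= _]/gap !xE // ltnW.
(* The origin supplies the nonzero constant term. *)
have br0 : 0 \in r.
  apply/rP; split=> // i _; have x0 j : coords (0 : 'rV[int]_m.+1) j = 0.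
    by case: j => // j; rewrite /= mxE.
  by rewrite /gap !x0 !mulr0 subrr lexx width_gt0.
have t_ge0 : 0 <= t m.+1.
  apply: (gap_le (x := fun=> 0) S_gt0 (n := m.+1)) => [|i im|//].
    by rewrite bt.1.
  by rewrite /gap !mulr0 subrr; have /andP[] := bt.2 i im.
apply: (@palindromic_reflect _ r w (f t) `|t m.+1|%N 0) => //.
- exact: perm_f.
- move=> l lr; apply/eqP; rewrite -eqz_nat PoszD gez0_abs // !wE ?fr // fE //.
  have bl := (rP l).1 lr; rewrite (reflect_box_eq S_gt0 bt bl).2.
    by apply/eqP; ring.
  by move=> i im; apply: maxt.
- by apply/eqP; rewrite -eqz_nat wE //= mxE.
Qed.

Theorem theorem8p2 (R : realType) (s : nat -> nat)
    (hs : forall i : nat, (0 < i)%N -> (0 < s i)%N) :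
  palindromic (inflated_eulerian R s 1) /\
  (forall n : nat, (2 <= n)%N ->
   forall p q : nat, (0 < p)%N -> (0 < q)%N -> coprime p q ->
     (s n)%:Q / (s n.-1)%:Q = p%:Q / q%:Q ->
   forall e : seq nat, is_estar s n e ->
     (palindromic (inflated_eulerian R s n) <->
      palindromic (inflated_eulerian R s n.-1) /\
      (p%:Z * (entry e n.-1)%:Z = -1 %[mod q%:Z])%Z)).
Proof.
have S_gt0 := unit_at0_gt0 hs.
split=> [|[|[|m]] // _ p q p0 q0 cpq pqE e estar_e].
  apply/palindromic_top_point => //.
  (* The only gap is x_1, which ranges over 0, ..., s_1 - 1. *)
  exists (fun i => if i is 0 then 0 else (s 1%N)%:Z - 1).
  have s1 := hs 1%N isT.
  split=> [|x bx [|//] _].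
    by split=> // -[|//] _; rewrite /gap /width /= mulr0 subr0 !mul1r; lia.
  have := bx.2 0%N isT; rewrite /gap /width bx.1 /= !mulr0 !subr0 !mul1r; lia.
have [g sq sp] : exists2 g, s m.+1 = (q * g)%N & s m.+2 = (p * g)%N.
  have sqp : (s m.+2 * q = p * s m.+1)%N.
    move/eqP: pqE; rewrite eqr_div ?pnatr_eq0 -?lt0n ?hs //.
    by rewrite -!intrM eqr_int -!PoszM eqz_nat => /eqP.
  have /dvdnP[g sg] : (q %| s m.+1)%N.
    rewrite -(Gauss_dvdr _ (_ : coprime q p)) 1?coprime_sym //.
    by rewrite -sqp dvdn_mull.
  exists g; first by rewrite mulnC.
  by apply/eqP; rewrite -(eqn_pmul2r q0) sqp sg; apply/eqP; lia.
rewrite !palindromic_top_point //=; split.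
  move=> [t top_t]; have top_t' := top_pointW S_gt0 top_t.
  split; first by exists t.
  have [a tE] := top_point_estar hs top_t' estar_e.
  have := top_point_last_gap (p := p) (q := q) (g := g)
    S_gt0 (ltn0Sn m) cpq sq sp top_t.
  rewrite tE sq PoszM => gap_t.
  apply/eqP; rewrite eqz_mod_dvd; apply/dvdzP.
  (* Substituting t_{n-1} = q g a - e_{n-1} into q t_n - p t_{n-1} = pqg - 1 gives p e_{n-1} + 1 = q
     (pg + pga - t_n). *)
  exists (p%:Z * g%:Z + p%:Z * g%:Z * a%:Z - t m.+2).
  by rewrite -[1]opprK; move: gap_t; lra.
move=> [[t top_t] /eqP]; rewrite eqz_mod_dvd => /dvdzP[k kE].
have [a tE] := top_point_estar hs top_t estar_e.
(* The same identity with p e_{n-1} + 1 = k q, solved for the last coordinate. *)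
pose z := p%:Z * g%:Z * a%:Z - k + p%:Z * g%:Z.
have tz : q%:Z * z - p%:Z * t m.+1 = p%:Z * q%:Z * g%:Z - 1.
  by rewrite /z tE sq PoszM; move: kE; lra.
eexists; exact: (top_point_extend (s := unit_at0 s) (n := m.+1)
  S_gt0 sq sp top_t tz).
Qed.
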